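(* Let $n\ge 2$, let $\mathbb{F}_n$ be the free group on $n$ generators $a_1,\dots,a_n$, and let $X=\{L_{a_1},L_{a_2},\dots,L_{a_n}\}$ be the set of standard generators of the group von Neumann algebra $L(\mathbb{F}_n)$. Then $$\text{Føl}(L(\mathbb{F}_n),X)\le\sqrt{2-\frac{2}{n^2}}.$$
   Context: Group von Neumann algebra: for a discrete group $G$, $L(G)\subseteq B(\ell^2(G))$ is the weak-operator closure of the span of the left translations $L_g$ ($L_g h=gh$ on the orthonormal basis $G$ of $\ell^2(G)$), with trace $\tau(T)=\langle Te,e\rangle$, where $e$ is the identity of $G$; $L^2(L(G),\tau)\cong\ell^2(G)$. For $n\ge2$, $L(\mathbb{F}_n)$ is a type $II_1$ factor. Hilbert–Schmidt notation: for a separable Hilbert space $\mathcal{H}$, $\|T\|_{H.S.}=Tr(T^*T)^{1/2}$ and $\langle A,B\rangle_{H.S.}=Tr(B^*A)$, where $Tr$ is the usual unnormalized trace on $B(\mathcal{H})$. Also $[x,e]=xe-ex$. Let $\mathcal{M}$ be a type $II_1$ factor with separable predual and faithful normal tracial state $\tau$, acting standardly on $\mathcal{H}=L^2(\mathcal{M},\tau)$, with unitary group $\mathcal{U}(\mathcal{M})$. For a finite set $X=\{x_1,\dots,x_k\}\subset\mathcal{U}(\mathcal{M})$ and $\varepsilon>0$, the property $Q(X,\varepsilon)$ is: there exists a nonzero finite-rank projection $e\in B(\mathcal{H})$ such that for all $j\in\{1,\dots,k\}$, $$\|[x_j,e]\|_{H.S.}\le\varepsilon\|e\|_{H.S.}\quad\text{and}\quad\left|\tau(x_j)-\frac{\langle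 x_je,e\rangle_{H.S.}}{\langle e,e\rangle_{H.S.}}\right|\le\varepsilon.$$ Define $\text{Føl}(\mathcal{M},X)=\inf\{\varepsilon>0: Q(X,\varepsilon)\text{ holds}\}$. *)

(* Defs.v *)
From HB Require Import structures.
From mathcomp Require Import all_boot all_order all_algebra.
From mathcomp Require Import finmap complex.
From mathcomp Require Import all_classical all_reals.
From mathcomp Require Import ereal esum numfun.
From mathcomp Require Import ring lra.

Set Implicit Arguments.
Unset Strict Implicit.
Unset Printing Implicit Defensive.
Import Order.TTheory GRing.Theory Num.Theory.

Local Open Scope classical_set_scope.
Local Open Scope ring_scope.

(* Elements are the reduced words in the letters a_i (encoded (i, false)) and
   a_i^-1 (encoded (i, true)); the product is concatenation followed by free
   reduction. *)
Section FreeGroup.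
Variable n : nat.

Definition letter : Type := ('I_n * bool)%type.

HB.instance Definition _ := Countable.on letter.

Definition letterV (a : letter) : letter := (a.1, ~~ a.2).

Definition reduced (w : seq letter) : bool :=
  sorted (fun a b => b != letterV a) w.

Record free_group := FreeGroup { word :> seq letter; word_reduced : reduced word }.

HB.instance Definition _ := [isSub for word].
HB.instance Definition _ := [Countable of free_group by <:].

Definition word_push (a : letter) (w : seq letter) : seq letter :=
  if w is b :: w' then if b == letterV a then w' else a :: w else [:: a].

Definition word_mul (u v : seq letter) : seq letter := foldr word_push v u.

Definition word_inv (w : seq letter) : seq letter := rev (map letterV w).

Lemma letterVK : involutive letterV.
Proof. by case=> i b; rewrite /letterV /= negbK. Qed.

Lemma reduced_push a w : reduced w -> reduced (word_push a w).
Proof.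
case: w => [|b w] //= rw; case: eqP => [_|/eqP nb]; first exact: path_sorted rw.
by rewrite /reduced /= nb.
Qed.

Lemma reduced_mul u v : reduced v -> reduced (word_mul u v).
Proof. by move=> rv; elim: u => //= a u IH; exact: reduced_push. Qed.

Lemma word_pushK a w : reduced w -> word_push a (word_push (letterV a) w) = w.
Proof.
case: w => [|b w] /= rw; first by rewrite eqxx.
rewrite letterVK; case: eqP => [eb|_] /=; last by rewrite eqxx.
move: rw; rewrite eb; case: w => [|c w] //= /andP[/negbTE nc _].
by rewrite nc.
Qed.

Lemma word_mul_push a u v : reduced v ->
  word_mul (word_push a u) v = word_push a (word_mul u v).
Proof.
move=> rv; case: u => [|b u] //=; case: eqP => [->|//].
by rewrite word_pushK //; exact: reduced_mul.
Qed.

Lemma word_mulA u v w : reduced w ->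
  word_mul u (word_mul v w) = word_mul (word_mul u v) w.
Proof. by move=> rw; elim: u => //= a u ->; rewrite word_mul_push. Qed.

Lemma word_mul_nil w : reduced w -> word_mul w [::] = w.
Proof.
elim: w => //= a w IH rw; rewrite IH; last exact: path_sorted rw.
by case: w rw {IH} => [|b w] //= /andP[/negbTE->].
Qed.

Lemma word_inv_cons a w : word_inv (a :: w) = rcons (word_inv w) (letterV a).
Proof. by rewrite /word_inv /= rev_cons. Qed.

Lemma word_mulV w : word_mul (word_inv w) w = [::] .
Proof.
rewrite /word_inv; elim: w => //= a w IH.
by rewrite rev_cons /word_mul foldr_rcons /= letterVK eqxx.
Qed.

Lemma word_invK : involutive word_inv.
Proof.
by move=> w; rewrite /word_inv map_rev revK -map_comp map_id_in// => a _ /=; exact: letterVK.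
Qed.

Lemma reduced_inv w : reduced w -> reduced (word_inv w).
Proof.
rewrite /reduced /word_inv rev_sorted sorted_map; apply: sub_sorted => a b /=.
by rewrite letterVK eq_sym.
Qed.

Definition free_mul (u v : free_group) : free_group :=
  FreeGroup (reduced_mul u (word_reduced v)).
Definition free_one : free_group := @FreeGroup [::] isT.
Definition free_inv (u : free_group) : free_group :=
  FreeGroup (reduced_inv (word_reduced u)).

Lemma free_mulA : associative free_mul.
Proof. by move=> u v w; apply: val_inj; apply: word_mulA (word_reduced w). Qed.
Lemma free_mul1 : left_id free_one free_mul.
Proof. by move=> u; apply: val_inj. Qed.
Lemma free_mulr1 : right_id free_one free_mul.
Proof. by move=> u; apply: val_inj; apply: word_mul_nil (word_reduced u). Qed.
Lemma free_mulV : left_inverse free_one free_inv free_mul.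
Proof. by move=> u; apply: val_inj; apply: word_mulV. Qed.
Lemma free_mulrV : right_inverse free_one free_inv free_mul.
Proof.
by move=> u; apply: val_inj; rewrite /= -{1}(word_invK u); apply: word_mulV.
Qed.

HB.instance Definition _ := isGroup.Build free_group
  free_mulA free_mul1 free_mulr1 free_mulV free_mulrV.

Definition free_gen (i : 'I_n) : free_group := @FreeGroup [:: (i, false)] isT.

End FreeGroup.

Section L2.
Variables (R : realType) (I : choiceType).
Local Notation C := R[i].
Local Notation cmod := (@Normc.normc R).

(* Sum of an absolutely summable family, as the difference of the sums of its
   positive and negative parts; meaningless if the family is not summable. *)
Definition rsum (u : I -> R) : R :=
  fine (\esum_(i in [set: I]) (Num.max (u i) 0)%:E)
  - fine (\esum_(i in [set: I]) (Num.max (- u i) 0)%:E).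

Definition csum (u : I -> C) : C :=
  Complex (rsum (fun i => complex.Re (u i))) (rsum (fun i => complex.Im (u i))).

Definition sqnorm (f : I -> C) : \bar R :=
  \esum_(i in [set: I]) (cmod (f i) ^+ 2)%:E.

Definition sqsummable : {pred I -> C} := fun f => `[< (sqnorm f < +oo)%E >].

Lemma sqsummable_submod : submod_closed sqsummable.
Proof.
have cmodE (z : C) : cmod z ^+ 2 = complex.Re z ^+ 2 + complex.Im z ^+ 2.
  by case: z => a b; rewrite /= sqr_sqrtr // addr_ge0 ?sqr_ge0.
split.
  apply/asboolP; rewrite /sqnorm esum1 ?ltry// => i _.
  by rewrite cmodE /= !expr0n /= addr0.
move=> a f g /asboolP hf /asboolP hg; apply/asboolP.
pose c : R := 2 * cmod a ^+ 2.
have c0 : 0 <= c by rewrite mulr_ge0 ?sqr_ge0.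
pose h : I -> C := fun i => a * f i + g i.
have le : (sqnorm h <= c%:E * sqnorm f + (2 : R)%:E * sqnorm g)%E.
  apply: ge_ereal_sup => _ [A [finA _] <-].
  rewrite fsumEFin //.
  apply: (@le_trans _ _ ((c * \sum_(x \in A) cmod (f x) ^+ 2)
       + 2 * \sum_(x \in A) cmod (g x) ^+ 2)%:E).
    rewrite lee_fin !fsbig_finite //= !mulr_sumr -big_split /=.
    apply: ler_sum => i _; rewrite /c /h !cmodE.
    case: (a) (f i) (g i) => [a1 a2] [f1 f2] [g1 g2] /=.
    rewrite -subr_ge0.
    rewrite (_ : _ - _ = (a1 * f1 - a2 * f2 - g1) ^+ 2
                         + (a1 * f2 + a2 * f1 - g2) ^+ 2); last by ring.
    by rewrite addr_ge0 ?sqr_ge0.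
  rewrite EFinD !EFinM; apply: leeD; apply: lee_wpmul2l; rewrite ?lee_fin //;
    by rewrite -fsumEFin //; apply: ereal_sup_ubound; exists A.
apply: (le_lt_trans le); rewrite lte_add_pinfty// lte_mul_pinfty//.
all: by rewrite lee_fin.
Qed.

HB.instance Definition _ := GRing.isSubmodClosed.Build C (I -> C) sqsummable
  sqsummable_submod.

Record l2 := L2 { l2_fun :> I -> C; l2_sqsummable : l2_fun \in sqsummable }.

HB.instance Definition _ := [isSub for l2_fun].
HB.instance Definition _ := [Choice of l2 by <:].
HB.instance Definition _ := [SubChoice_isSubLmodule of l2 by <:].

Definition dot (x y : l2) : C := csum (fun i => x i * (y i)^*%C).

Definition l2norm (x : l2) : R := Num.sqrt (fine (sqnorm x)).

Lemma esum_supp1 (a : I -> \bar R) (i : I) :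
  (forall j, j != i -> a j = 0%E) -> (0 <= a i)%E ->
  \esum_(j in [set: I]) a j = a i.
Proof.
move=> a0 ai; rewrite -(esum_set1 ai) [RHS]esum_mkcond.
congr esum; apply/funext => j; case: ifPn => //.
by rewrite notin_setE /= => /eqP/a0.
Qed.

Lemma csum_supp1 (u : I -> C) (i : I) :
  (forall j, j != i -> u j = 0) -> csum u = u i.
Proof.
have rsum1 (v : I -> R) : (forall j, j != i -> v j = 0) -> rsum v = v i.
  move=> v0; rewrite /rsum !(@esum_supp1 _ i) ?lee_fin ?le_max ?lexx ?orbT //=.
  - by case: (leP (v i) 0) => vi; case: (leP (- v i) 0); lra.
  - by move=> j /v0 ->; rewrite oppr0 maxxx.
  - by move=> j /v0 ->; rewrite maxxx.
move=> u0; rewrite /csum !rsum1; first by case: (u i).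
  by move=> j /u0 ->.
by move=> j /u0 ->.
Qed.

Lemma delta_sqsummable (i : I) : (fun j => (j == i)%:R : C) \in sqsummable.
Proof.
apply/asboolP; rewrite /sqnorm (@esum_supp1 _ i) ?ltry ?lee_fin ?sqr_ge0 //.
by move=> j /negbTE ->; rewrite Normc.normc0 expr0n.
Qed.

Definition delta (i : I) : l2 := L2 (delta_sqsummable i).

Lemma dot_delta (x : l2) (i : I) : dot x (delta i) = x i.
Proof.
rewrite /dot (@csum_supp1 _ i) /= ?eqxx ?conjc1 ?mulr1 // => j /negbTE ->.
by rewrite conjc0 mulr0.
Qed.

Lemma delta_dot (x : l2) (i : I) : dot (delta i) x = (x i)^*%C.
Proof.
by rewrite /dot (@csum_supp1 _ i) /= ?eqxx ?mul1r // => j /negbTE ->; rewrite mul0r.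
Qed.

Definition bounded_op : set (l2 -> l2) :=
  [set T | linear T /\ exists M : R, forall x, l2norm (T x) <= M * l2norm x].

Definition is_adjoint (T S : l2 -> l2) : Prop :=
  forall x y, dot (T x) y = dot x (S y).

(* The adjoint is unique (adjE); it exists for every bounded operator. *)
Definition adj (T : l2 -> l2) : l2 -> l2 := xget (fun=> 0) (is_adjoint T).

Lemma adjE (T S : l2 -> l2) : is_adjoint T S -> adj T = S.
Proof.
move=> TS; apply: xget_unique => // S' TS'; apply/funext => y.
apply/val_inj/funext => i; apply: (can_inj (@conjcK R)).
by rewrite -!delta_dot -TS -TS'.
Qed.

Definition unitary_op (u : l2 -> l2) : Prop :=
  [/\ bounded_op u, adj u \o u = id & u \o adj u = id].

Definition projection (e : l2 -> l2) : Prop :=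
  [/\ bounded_op e, e \o e = e & adj e = e].

Definition finite_rank (T : l2 -> l2) : Prop :=
  exists s : seq l2, forall x, exists c : l2 -> C, T x = \sum_(v <- s) c v *: v.

(* The trace of a trace-class operator, computed in the canonical basis. *)
Definition trace (T : l2 -> l2) : C := csum (fun i => dot (T (delta i)) (delta i)).

(* The [0, +oo]-valued trace of a positive operator. *)
Definition trace_pos (T : l2 -> l2) : \bar R :=
  \esum_(i in [set: I]) (complex.Re (dot (T (delta i)) (delta i)))%:E.

Definition HSnorm (T : l2 -> l2) : \bar R := sqrte (trace_pos (adj T \o T)).

Definition HSdot (A B : l2 -> l2) : C := trace (adj B \o A).

Definition commutator (x e : l2 -> l2) : l2 -> l2 := fun v => x (e v) - e (x v).

Definition wot_closure (A : set (l2 -> l2)) : set (l2 -> l2) :=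
  [set T | bounded_op T /\
    forall (s : seq (l2 * l2)) (eps : R), 0 < eps ->
    exists2 S, A S &
      forall p, p \in s -> cmod (dot (T p.1) p.2 - dot (S p.1) p.2) < eps].

Record unitary_of (M : set (l2 -> l2)) := UnitaryOf {
  unitary_elt :> M;
  unitary_eltP : unitary_op (set_val unitary_elt)
}.

(* The family x enumerates X. M acts on the standard space l2 I = L^2(M, tau). *)
Definition folner_prop (M : set (l2 -> l2)) (tau : M -> C) (k : nat)
    (x : 'I_k -> unitary_of M) (eps : R) : Prop :=
  exists e : l2 -> l2, [/\ projection e, finite_rank e, e <> (fun=> 0) &
    forall j : 'I_k, let xj : l2 -> l2 := set_val (x j) in
      (HSnorm (commutator xj e) <= eps%:E * HSnorm e)%E /\
      cmod (tau (x j) - HSdot (xj \o e) e / HSdot e e) <= eps].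

(* The infimum is taken in the extended reals, so that inf of the empty set
   would be +oo. *)
Definition Fol (M : set (l2 -> l2)) (tau : M -> C) (k : nat)
    (x : 'I_k -> unitary_of M) : \bar R :=
  ereal_inf [set eps%:E | eps in [set eps : R | 0 < eps /\ folner_prop tau x eps]].

End L2.

Arguments Fol {R I} M tau {k} x.

Section GroupVonNeumannAlgebra.
Variables (R : realType) (G : groupType).
Local Notation C := R[i].
Local Notation H := (l2 R G).

Lemma esum_translate (a : G -> \bar R) (g : G) :
  \esum_(h in [set: G]) a (g * h)%g = \esum_(h in [set: G]) a h.
Proof.
rewrite [RHS](@reindex_esum _ _ _ [set: G] _ (fun h => g * h)%g) //.
split=> //; first by move=> h1 h2 _ _; exact: mulgI.
by move=> h _; exists (g^-1 * h)%g => //; rewrite mulVKg.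
Qed.

Lemma csum_translate (u : G -> C) (g : G) :
  csum (fun h => u (g * h)%g) = csum u.
Proof.
by congr Complex; congr (fine _ - fine _);
  [rewrite -[RHS](esum_translate _ g)..].
Qed.

Lemma ltrans_sqsummable (g : G) (x : H) :
  (fun h => x (g^-1 * h)%g) \in @sqsummable R G.
Proof.
apply/asboolP; rewrite /sqnorm.
rewrite (esum_translate (fun h => (Normc.normc (x h) ^+ 2)%:E)).
by have /asboolP := l2_sqsummable x.
Qed.

Definition ltrans (g : G) (x : H) : H := L2 (ltrans_sqsummable g x).

Lemma ltrans_delta (g h : G) : ltrans g (delta R h) = delta R (g * h)%g.
Proof.
apply/val_inj/funext => k /=; congr (_%:R); congr nat_of_bool.
by apply/eqP/eqP => [<-|->]; rewrite ?mulVKg ?mulKg.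
Qed.

Lemma bounded_ltrans g : bounded_op (ltrans g).
Proof.
split=> [a x y|]; first exact/val_inj.
exists 1 => x; rewrite mul1r /l2norm /sqnorm /=.
by rewrite (esum_translate (fun h => (Normc.normc (x h) ^+ 2)%:E)).
Qed.

Lemma ltransK g : cancel (ltrans g) (ltrans g^-1).
Proof. by move=> x; apply/val_inj/funext => h /=; rewrite invgK mulKg. Qed.

Lemma ltransVK g : cancel (ltrans g^-1) (ltrans g).
Proof. by move=> x; apply/val_inj/funext => h /=; rewrite invgK mulVKg. Qed.

Lemma adj_ltrans g : adj (ltrans g) = ltrans g^-1.
Proof.
apply: adjE => x y; rewrite /dot -[LHS](csum_translate _ g) /=.
by congr csum; apply/funext => h; rewrite mulKg invgK.
Qed.

Definition group_span : set (H -> H) :=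
  [set T | exists s : seq (C * G),
    T = fun x => \sum_(p <- s) p.1 *: ltrans p.2 x].

Definition group_vN : set (H -> H) := wot_closure group_span.

Definition group_trace (T : group_vN) : C :=
  dot (set_val T (delta R 1%g)) (delta R 1%g).

Lemma ltrans_group_vN g : ltrans g \in group_vN.
Proof.
apply/mem_set; split; first exact: bounded_ltrans.
move=> s eps eps0; exists (ltrans g); last first.
  by move=> p _; rewrite subrr Normc.normc0.
by exists [:: (1, g)]; apply/funext => x; rewrite big_seq1 scale1r.
Qed.

Lemma unitary_ltrans g : unitary_op (ltrans g).
Proof.
split; [exact: bounded_ltrans| |]; rewrite adj_ltrans.
  by apply/funext => x /=; rewrite ltransK.
by apply/funext => x /=; rewrite ltransVK.
Qed.

Definition group_unitary (g : G) : unitary_of group_vN :=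
  @UnitaryOf R G group_vN (SigSub (ltrans_group_vN g)) (unitary_ltrans g).

End GroupVonNeumannAlgebra.

Arguments group_vN R G : clear implicits.
Arguments group_trace {R G} T.
Arguments group_unitary R {G} g.

(* Main.v *)
Require Import Defs.
From mathcomp Require Import all_boot all_order all_algebra.
From mathcomp Require Import complex.
From mathcomp Require Import all_classical all_reals.
From mathcomp Require Import ereal esum.
From mathcomp Require Import ring lra.

(** Take for e the projection of l2(F_n) onto the span of the n + 1 basis
    vectors indexed by F = {1, a_1, ..., a_n}.  For a subset projection,
    ||[L_g, e]||^2 counts the symmetric difference of F and g^-1 F; for g = a_i
    the point 1 lies in both sets, so this is at most 2n, and
    2n <= (2 - 2/n^2)(n + 1) because n^2 >= n + 1.  The trace condition
    is trivial: L_g has no diagonal entries for g <> 1, so both tau(L_g) and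
    <L_g e, e> vanish. *)

Set Implicit Arguments.
Unset Strict Implicit.
Unset Printing Implicit Defensive.
Import Order.TTheory GRing.Theory Num.Theory.

Local Open Scope classical_set_scope.
Local Open Scope ring_scope.

Section CoordinateProjection.
Variables (R : realType) (I : choiceType).
Local Notation C := R[i].

Lemma csum0 (u : I -> C) : (forall i, u i = 0) -> csum u = 0.
Proof.
move=> u0; have rsum0 (v : I -> R) : (forall i, v i = 0) -> rsum v = 0.
  by move=> v0; rewrite /rsum !esum1 ?subrr// => i _; rewrite v0 ?oppr0 maxxx.
by rewrite /csum !rsum0// => i; rewrite u0.
Qed.

Lemma esum_mem_seq (s : seq I) : uniq s ->
  \esum_(i in [set: I]) ((i \in s)%:R)%:E = (size s)%:R%:E :> \bar R.
Proof.
elim: s => [|a s IH] /=; first by rewrite esum1.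
case/andP=> as_ us.
(* Since [a] is not in [s], the indicator of [a :: s] is the point mass at [a] plus the indicator of
   [s]. *)
rewrite (eq_esum (b := fun i => ((i == a)%:R%:E + (i \in s)%:R%:E)%E)); last first.
  move=> i _; rewrite in_cons; case: eqP => [->|_] /=; last by rewrite add0e.
  by rewrite (negbTE as_) adde0.
rewrite esumD; [|by move=> i _; rewrite lee_fin ler0n..].
rewrite IH// (@esum_supp1 _ _ _ a) ?eqxx ?lee_fin ?ler01//; last first.
  by move=> j /negbTE ->.
by rewrite -EFinD -natr1 addrC.
Qed.

Lemma sqnorm_restrict_le (A : pred I) (x : I -> C) :
  (sqnorm (fun i => (A i)%:R * x i)%R <= sqnorm x)%E.
Proof.
apply: le_esum => i _; case: (A i); rewrite ?mul1r// mul0r Normc.normc0 expr0n.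
by rewrite lee_fin sqr_ge0.
Qed.

Lemma sqsummable_restrict (A : pred I) (x : l2 R I) :
  (fun i => (A i)%:R * x i) \in @sqsummable R I.
Proof.
apply/asboolP; apply: le_lt_trans (sqnorm_restrict_le A x) _.
by have /asboolP := l2_sqsummable x.
Qed.

Definition coord_proj (A : pred I) (x : l2 R I) : l2 R I :=
  L2 (sqsummable_restrict A x).

Lemma conjc_bool (b : bool) : (b%:R : C)^*%C = b%:R.
Proof. by case: b; rewrite ?conjc1 ?conjc0. Qed.

Lemma adj_coord_proj A : adj (coord_proj A) = coord_proj A.
Proof.
apply: adjE => x y; congr csum; apply/funext => i /=.
by rewrite rmorphM /= conjc_bool mulrCA mulrA.
Qed.

Lemma coord_proj_idem A : coord_proj A \o coord_proj A = coord_proj A.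
Proof.
apply/funext => x; apply/val_inj/funext => i /=.
by case: (A i); rewrite ?mul1r ?mul0r.
Qed.

Lemma projection_coord_proj A : projection (coord_proj A).
Proof.
split; [split | exact: coord_proj_idem | exact: adj_coord_proj].
  by move=> a x y; apply/val_inj/funext => i /=; rewrite mulrDr mulrCA.
exists 1 => x; rewrite mul1r; apply: ler_wsqrtr.
(* [fine] is monotone only between finite values, so the summability of [x] is used to bound both
   square norms. *)
have /asboolP xfin := l2_sqsummable x; have le := sqnorm_restrict_le A x.
have ge0 (y : I -> C) : (0 <= sqnorm y)%E.
  by apply: esum_ge0 => i _; rewrite lee_fin sqr_ge0.
by apply: fine_le => //; rewrite ge0_fin_numE// (le_lt_trans le).
Qed.

Lemma finite_rank_coord_proj (s : seq I) :
  uniq s -> finite_rank (coord_proj (mem s)).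
Proof.
(* The spanning list is orthonormal, so the coefficient of each vector is its inner product with
   [x]; a repeated index would be counted twice, hence [uniq s]. *)
move=> us; exists [seq delta R i | i <- s] => x; exists (dot x).
rewrite big_map; apply/val_inj/funext => i.
rewrite raddf_sum fct_sumE /=.
under eq_bigr => j _ do rewrite dot_delta.
case: (boolP (i \in s)) => si; last first.
  rewrite mul0r big_seq big1// => j sj.
  by rewrite [LHS](_ : _ = x j * (i == j)%:R)//;
     case: eqP si => [->|]; rewrite ?sj ?mulr0.
rewrite mul1r (bigD1_seq i)//= big1 ?addr0 => [|j ji].
  by rewrite [RHS](_ : _ = x i * (i == i)%:R)// eqxx mulr1.
by rewrite [LHS](_ : _ = x j * (i == j)%:R)// eq_sym (negbTE ji) mulr0.
Qed.

Lemma coord_proj_neq0 (A : pred I) i : A i -> coord_proj A <> (fun=> 0).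
Proof.
move=> Ai /(congr1 (fun T : l2 R I -> l2 R I => T (delta R i) i)) /= /eqP.
by rewrite Ai eqxx mulr1 oner_eq0.
Qed.

(** As e* e = e, the trace counts the ones on the diagonal of e. *)
Lemma HSnorm_coord_proj (s : seq I) : uniq s ->
  HSnorm (coord_proj (mem s)) = (Num.sqrt (size s)%:R)%:E.
Proof.
move=> us; rewrite /HSnorm adj_coord_proj coord_proj_idem /trace_pos.
rewrite (eq_esum (b := fun i => (i \in s)%:R%:E)) ?esum_mem_seq// => i _.
by rewrite dot_delta /= eqxx mulr1; case: (i \in s).
Qed.

End CoordinateProjection.

Section Translation.
Variables (R : realType) (G : groupType).
Local Notation C := R[i].

(** This is (xe - ex)* = e x* - x* e with e self-adjoint and x unitary. It is checked on inner
    products after reindexing the sum by h -> g h. *)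
Lemma adj_commutator_ltrans (g : G) (A : pred G) :
  adj (commutator (@ltrans R G g) (coord_proj A)) =
  commutator (coord_proj A) (ltrans g^-1).
Proof.
apply: adjE => x y; rewrite /dot -[LHS](csum_translate _ g).
congr csum; apply/funext => h.
rewrite [LHS](_ : _ = ((A (g^-1 * (g * h)))%g%:R * x (g^-1 * (g * h))%g
   - (A (g * h)%g)%:R * x (g^-1 * (g * h))%g) * (y (g * h)%g)^*%C)//.
rewrite [RHS](_ : _ = x h * ((A h)%:R * y (g^-1^-1 * h)%g
   - (A (g^-1^-1 * h)%g)%:R * y (g^-1^-1 * h)%g)^*%C)//.
rewrite mulKg invgK rmorphB !rmorphM /= !conjc_bool.
by ring.
Qed.

(** The commutator sends [delta h] to (1_A(h) - 1_A(gh)) times [delta (g * h)], so each diagonal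
    entry of its square is 1 when exactly one of h, gh lies in A, and 0 otherwise. *)
Lemma HSnorm_commutator_ltrans (g : G) (A : pred G) :
  HSnorm (commutator (@ltrans R G g) (coord_proj A)) =
  sqrte (\esum_(h in [set: G]) ((A h (+) A (g * h)%g)%:R)%:E).
Proof.
rewrite /HSnorm adj_commutator_ltrans /trace_pos; congr sqrte.
apply: eq_esum => h _; rewrite dot_delta; congr EFin.
rewrite (_ : l2_fun _ h =
  (A h)%:R * ((A (g^-1 * (g^-1^-1 * h)))%g%:R * (g^-1 * (g^-1^-1 * h) == h)%g%:R
   - (A (g^-1^-1 * h)%g)%:R * (g^-1 * (g^-1^-1 * h) == h)%g%:R)
  - (A (g^-1^-1 * h)%g)%:R * ((A (g^-1 * (g^-1^-1 * h)))%g%:R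
      * (g^-1 * (g^-1^-1 * h) == h)%g%:R
   - (A (g^-1^-1 * h)%g)%:R * (g^-1 * (g^-1^-1 * h) == h)%g%:R) :> C)//.
rewrite invgK mulKg eqxx !mulr1.
by case: (A h); case: (A _); rewrite /= ?mulr1 ?mul1r ?mul0r ?subrr ?subr0 ?sub0r
  ?opprK ?addr0.
Qed.

Lemma HSnorm_commutator_ltrans_le (g : G) (s : seq G) :
  uniq s -> 1%g \in s -> g \in s ->
  (HSnorm (commutator (@ltrans R G g) (coord_proj (mem s)))
   <= (Num.sqrt (2 * (size s)%:R - 2))%:E)%E.
Proof.
move=> us s1 sg; rewrite HSnorm_commutator_ltrans.
set S := (\esum_(h in _) _).
(* Moving 2 to the left turns the bound into an inequality between sums of nonnegative terms. *)
suff le : (S + 2%:E <= (2 * (size s)%:R)%:E)%E.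
  rewrite -[leRHS]/(sqrte (2 * (size s)%:R - 2)%:E).
  have S0 : (0 <= S)%E by apply: esum_ge0 => h _; rewrite lee_fin ler0n.
  have leS : (S <= (2 * (size s)%:R - 2)%:E)%E by rewrite EFinB leeBrDr.
  by rewrite lee_sqrt// (le_trans S0).
have nat_ge0 (k : nat) : (0 <= k%:R%:E :> \bar R)%E by rewrite lee_fin ler0n.
(* Writing 2 as a mass concentrated at h = 1 allows a termwise comparison: xor is at most the sum of
   the two indicators, and at h = 1 the xor is 0 while both indicators are 1. *)
have -> : (2%:E = \esum_(h in [set: G]) (2 * (h == 1%g))%N%:R%:E :> \bar R)%E.
  by rewrite (@esum_supp1 _ _ _ 1%g) ?eqxx// => h /negbTE ->; rewrite muln0.
rewrite -esumD//.
have -> : ((2 * (size s)%:R)%:E =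
    \esum_(h in [set: G]) ((h \in s)%:R%:E + (g * h \in s)%g%:R%:E) :> \bar R)%E.
  rewrite esumD// (esum_translate (fun h => (h \in s)%:R%:E)) esum_mem_seq//.
  by rewrite -EFinD; congr EFin; ring.
apply: le_esum => h _; rewrite -!EFinD lee_fin -!natrD ler_nat.
case: eqP => [->|_]; first by rewrite mulg1 /= s1 sg.
by rewrite muln0 addn0 /=; case: (h \in s); case: (_ \in s).
Qed.

Lemma HSdot_ltrans_coord_proj (g : G) (A : pred G) : (g != 1)%g ->
  HSdot (@ltrans R G g \o coord_proj A) (coord_proj A) = 0.
Proof.
move=> g1; apply: csum0 => h; rewrite dot_delta adj_coord_proj /=.
case: eqP => [|_]; last by rewrite !mulr0.
by rewrite -{2}[h]mul1g => /mulIg /eqP; rewrite invg_eq1 (negbTE g1).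
Qed.

Lemma group_trace_unitary (g : G) : (g != 1)%g ->
  group_trace (unitary_elt (group_unitary R g)) = 0.
Proof.
move=> g1; rewrite /group_trace dot_delta /= mulg1.
by rewrite invg_eq1 (negbTE g1).
Qed.

End Translation.

Lemma free_gen_inj (n : nat) : injective (@free_gen n).
Proof. by move=> i j []. Qed.

Theorem proposition13 (R : realType) (n : nat) (hn : (2 <= n)%N) :
  (Fol (group_vN R (free_group n)) group_trace
     (fun i : 'I_n => group_unitary R (free_gen i))
   <= (Num.sqrt (2 - 2 / n%:R ^+ 2))%:E)%E.
Proof.
have n2 : 2 <= n%:R :> R by rewrite (ler_nat R 2).
have nn0 : 0 < n%:R ^+ 2 :> R by rewrite exprn_gt0//; lra.
have eps2 : 0 < 2 - 2 / n%:R ^+ 2 :> R.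
  by rewrite subr_gt0 ltr_pdivrMr//; nra.
(* The bound itself is an admissible epsilon; [eps2] makes it positive. *)
apply: ereal_inf_lbound; eexists; [|reflexivity].
split; first by rewrite sqrtr_gt0.
pose s := 1%g :: [seq free_gen i | i <- enum 'I_n].
have us : uniq s.
  rewrite /= map_inj_uniq ?enum_uniq ?andbT; last exact: free_gen_inj.
  by apply/mapP => -[].
have s1 : 1%g \in s by rewrite mem_head.
have sg i : free_gen i \in s by rewrite inE map_f ?orbT ?mem_enum.
have sz : size s = n.+1 by rewrite /= size_map size_enum_ord.
exists (coord_proj (mem s)); split.
- exact: projection_coord_proj.
- exact: finite_rank_coord_proj.
- exact: (@coord_proj_neq0 _ _ _ 1%g).
move=> j xj; have g1 : (free_gen j != 1)%g by [].
split; last first.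
  (* Both the trace and the numerator of the quotient are 0, so the difference vanishes. *)
  by rewrite group_trace_unitary// HSdot_ltrans_coord_proj// mul0r subrr
    Normc.normc0 sqrtr_ge0.
apply: le_trans (HSnorm_commutator_ltrans_le R us s1 (sg j)) _.
rewrite HSnorm_coord_proj// -EFinM lee_fin -sqrtrM ?(ltW eps2)// sz.
apply: ler_wsqrtr; rewrite -[n.+1%:R]natr1 -subr_ge0.
set m := n%:R in n2 nn0 *.
(* Both sides are now under one root. The gap between the radicands is nonnegative because m >= 2
   gives m^2 >= 2m >= m + 1. *)
have -> : (2 - 2 / m ^+ 2) * (m + 1) - (2 * (m + 1) - 2)
          = 2 * (m ^+ 2 - m - 1) / m ^+ 2 by field; lra.
by rewrite divr_ge0// ?(ltW nn0)//; nra.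
Qed.
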